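(* For every formula $\phi$ of the language $\mathcal{RD}$, $\phi$ is valid if and only if $\phi$ is provable in the axiom system $\mathbf{RD}$.
   Context: Fix a countable set $\textsc{prop}$ of propositional variables and a finite set $\textsc{ag}$ of agents; $\textsc{gr}=\wp(\textsc{ag})\setminus\{\emptyset\}$ is the set of groups. The language $\mathcal{RD}$ is given by $\phi ::= p \mid \neg\phi \mid \phi\wedge\phi \mid K_i\phi \mid D_G\phi \mid R_G\phi$ with $p\in\textsc{prop}$, $i\in\textsc{ag}$, $G\in\textsc{gr}$. A model is $\mathfrak{M}=(S,\sim,V)$ with $S$ a set of states, $\sim$ assigning to each agent $i$ an equivalence relation $\sim_i$ on $S$, and $V:\textsc{prop}\to 2^S$. For a group $G$, $\sim_G=\bigcap_{i\in G}\sim_i$. The $G$-resolved update of $\mathfrak{M}$ is $\mathfrak{M}|_G=(S,\sim|_G,V)$ where $(\sim|_G)_i=\sim_G$ if $i\in G$ and $(\sim|_G)_i=\sim_i$ otherwise. Satisfaction: $\mathfrak{M},s\models p$ iff $s\in V(p)$; Boolean clauses as usual; $\mathfrak{M},s\models K_i\phi$ iff $\mathfrak{M},t\models\phi$ for all $t$ with $s\sim_i t$; $\mathfrak{M},s\models D_G\phi$ iff $\mathfrak{M},t\models\phi$ for all $t$ with $s\sim_G t$; $\mathfrak{M},s\models R_G\phi$ iff $\mathfrak{M}|_G,s\models\phi$. A formula is valid if it is true at every state of every model. The system $\mathbf{RD}$ consists of: (PC) all instances of propositional tautologies; (K) $K_i(\phi\to\psi)\to(K_i\phi\to K_i\psi)$;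 (T) $K_i\phi\to\phi$; (4) $K_i\phi\to K_iK_i\phi$; (5) $\neg K_i\phi\to K_i\neg K_i\phi$; (MP) from $\phi$ and $\phi\to\psi$ infer $\psi$; (N) from $\phi$ infer $K_i\phi$; (K$_D$) $D_G(\phi\to\psi)\to(D_G\phi\to D_G\psi)$; (T$_D$) $D_G\phi\to\phi$; (5$_D$) $\neg D_G\phi\to D_G\neg D_G\phi$; (D1) $K_i\phi\leftrightarrow D_{\{i\}}\phi$; (D2) $D_G\phi\to D_H\phi$ if $G\subseteq H$; (RA) $R_Gp\leftrightarrow p$; (RC) $R_G(\phi\wedge\psi)\leftrightarrow R_G\phi\wedge R_G\psi$; (RN) $R_G\neg\phi\leftrightarrow\neg R_G\phi$; (RD1) $R_GD_H\phi\leftrightarrow D_{G\cup H}R_G\phi$ if $G\cap H\neq\emptyset$; (RD2) $R_GD_H\phi\leftrightarrow D_HR_G\phi$ if $G\cap H=\emptyset$; (N$_R$) from $\phi$ infer $R_G\phi$. *)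

(* Defs.v *)
From Stdlib Require Import RelationClasses.
From mathcomp Require Import all_boot.

Set Implicit Arguments.
Unset Strict Implicit.
Unset Printing Implicit Defensive.

Definition group (ag : finType) : Type := {G : {set ag} | G != set0}.

Section Groups.
Variable ag : finType.
Implicit Types (i : ag) (G H : group ag).

Lemma group1_subproof i : [set i] != set0.
Proof. by apply/set0Pn; exists i; rewrite set11. Qed.

Definition group1 i : group ag := exist _ [set i] (group1_subproof i).

Lemma groupU_subproof G H : val G :|: val H != set0.
Proof.
by have /set0Pn[i iG] := valP G; apply/set0Pn; exists i; rewrite inE iG.
Qed.

Definition groupU G H : group ag := exist _ (val G :|: val H) (groupU_subproof G H).

End Groups.

Inductive form (prop : countType) (ag : finType) : Type :=
| FVar of prop
| FNeg of form prop ag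
| FAnd of form prop ag & form prop ag
| FK of ag & form prop ag
| FD of group ag & form prop ag
| FR of group ag & form prop ag.

Arguments FVar {prop ag} p.

Section Semantics.
Variables (prop : countType) (ag : finType).

Record model : Type := Model {
  state : Type;
  sim : ag -> state -> state -> Prop;
  sim_equiv : forall i, Equivalence (sim i);
  val_of : prop -> state -> Prop
}.

Definition simG (M : model) (G : group ag) (s t : state M) : Prop :=
  forall i, i \in val G -> sim i s t.

Definition upd_sim (M : model) (G : group ag) (i : ag) :
    state M -> state M -> Prop :=
  if i \in val G then simG G else sim i.

Lemma upd_sim_equiv (M : model) (G : group ag) (i : ag) :
  Equivalence (@upd_sim M G i).
Proof.
rewrite /upd_sim; case: ifP => _; last exact: sim_equiv.
split=> [s j _ | s t st j jG | s t u st tu j jG].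
- by have [r _ _] := sim_equiv M j; apply: r.
- by have [_ sy _] := sim_equiv M j; apply: sy; apply: st.
- by have [_ _ tr] := sim_equiv M j; apply: tr (st j jG) (tu j jG).
Qed.

Definition update (M : model) (G : group ag) : model :=
  Model (@upd_sim_equiv M G) (@val_of M).

Fixpoint sat (M : model) (s : state M) (phi : form prop ag) {struct phi} : Prop :=
  match phi with
  | FVar p => val_of p s
  | FNeg a => ~ sat s a
  | FAnd a b => sat s a /\ sat s b
  | FK i a => forall t, sim i s t -> sat t a
  | FD G a => forall t, simG G s t -> sat t a
  | FR G a => @sat (update M G) s a
  end.

Definition valid (phi : form prop ag) : Prop :=
  forall (M : model) (s : state M), sat s phi.

End Semantics.

Inductive pform : Type :=
| PVar of nat
| PNeg of pform
| PAnd of pform & pform.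

Fixpoint peval (v : nat -> bool) (a : pform) : bool :=
  match a with
  | PVar n => v n
  | PNeg b => ~~ peval v b
  | PAnd b c => peval v b && peval v c
  end.

Definition tautology (a : pform) : Prop := forall v, peval v a.

Section ProofSystem.
Variables (prop : countType) (ag : finType).
Local Notation form := (form prop ag).
Implicit Types (phi psi : form) (G H : group ag) (i : ag).

Definition FImp phi psi : form := FNeg (FAnd phi (FNeg psi)).
Definition FIff phi psi : form := FAnd (FImp phi psi) (FImp psi phi).

Fixpoint psubst (sigma : nat -> form) (a : pform) : form :=
  match a with
  | PVar n => sigma n
  | PNeg b => FNeg (psubst sigma b)
  | PAnd b c => FAnd (psubst sigma b) (psubst sigma c)
  end.

Inductive provable : form -> Prop :=
| RD_PC (sigma : nat -> form) (a : pform) :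
    tautology a -> provable (psubst sigma a)
| RD_K i phi psi :
    provable (FImp (FK i (FImp phi psi)) (FImp (FK i phi) (FK i psi)))
| RD_T i phi : provable (FImp (FK i phi) phi)
| RD_4 i phi : provable (FImp (FK i phi) (FK i (FK i phi)))
| RD_5 i phi : provable (FImp (FNeg (FK i phi)) (FK i (FNeg (FK i phi))))
| RD_MP phi psi : provable phi -> provable (FImp phi psi) -> provable psi
| RD_N i phi : provable phi -> provable (FK i phi)
| RD_KD G phi psi :
    provable (FImp (FD G (FImp phi psi)) (FImp (FD G phi) (FD G psi)))
| RD_TD G phi : provable (FImp (FD G phi) phi)
| RD_5D G phi : provable (FImp (FNeg (FD G phi)) (FD G (FNeg (FD G phi))))
| RD_D1 i phi : provable (FIff (FK i phi) (FD (group1 i) phi))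
| RD_D2 G H phi :
    val G \subset val H -> provable (FImp (FD G phi) (FD H phi))
| RD_RA G (p : prop) : provable (FIff (FR G (FVar p)) (FVar p))
| RD_RC G phi psi :
    provable (FIff (FR G (FAnd phi psi)) (FAnd (FR G phi) (FR G psi)))
| RD_RN G phi : provable (FIff (FR G (FNeg phi)) (FNeg (FR G phi)))
| RD_RD1 G H phi :
    val G :&: val H != set0 ->
    provable (FIff (FR G (FD H phi)) (FD (groupU G H) (FR G phi)))
| RD_RD2 G H phi :
    val G :&: val H = set0 ->
    provable (FIff (FR G (FD H phi)) (FD H (FR G phi)))
| RD_NR G phi : provable phi -> provable (FR G phi).

End ProofSystem.

(* Main.v *)
Require Import Defs.
From Stdlib Require Import RelationClasses.
From mathcomp Require Import all_boot.
From mathcomp Require Import boolp.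

(** Soundness is an induction on derivations. For completeness, the maximal
    consistent sets, related by [w ~_G w'] iff [w] and [w'] contain the same
    formulas [D_G psi], interpret each [D_G] correctly, except that [~_G] may be
    strictly smaller than the intersection of the [~_i], [i] in [G].
    This is repaired by secret sharing: a state is a maximal consistent set
    [w] together with, for each group [H] and formula [psi], bits held by the
    members of [H] whose sum modulo 2 is the truth value of [D_H psi] in [w].
    Agent [i] cannot distinguish two states in which [i] holds the same bits.
    Jointly the members of [G] know the truth values of all [D_G psi]; conversely
    a move along [~_G] can be realised without changing the bits held by [G],
    since every [H] not included in [G] has a member outside [G] whose bits can
    absorb the change.

    The operators [R_G] need no translation: if the states of [M] realise maximal
    consistent sets [v s], then those of the update of [M] by [G] realise the
    sets [{phi | R_G phi in v s}], so the truth lemma is a plain structural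
    induction over all such pairs [(M, v)]. *)

Set Implicit Arguments.
Unset Strict Implicit.
Unset Printing Implicit Defensive.

Section Completeness.
Variables (prop : countType) (ag : finType).
Local Notation form := (form prop ag).
Local Notation model := (model prop ag).
Implicit Types (phi psi chi a b c : form) (G H : group ag) (i j : ag).

(** * Soundness *)

Lemma sat_imp (M : model) (s : state M) a b :
  sat s (FImp a b) <-> (sat s a -> sat s b).
Proof.
split=> /= [nab sa | ab [sa nb]]; last exact: nb (ab sa).
by apply: contrapT => nb; apply: nab.
Qed.

Lemma sat_iff (M : model) (s : state M) a b :
  sat s (FIff a b) <-> (sat s a <-> sat s b).
Proof.
have -> : sat s (FIff a b) = (sat s (FImp a b) /\ sat s (FImp b a)) by [].
by rewrite !sat_imp.
Qed.

(** Each state induces a classical truth assignment on the variables of the schema, which reduces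
    soundness of (PC) to [tautology]. *)
Lemma sat_psubst (M : model) (s : state M) (sigma : nat -> form) (p : pform) :
  sat s (psubst sigma p) <-> peval (fun n => `[< sat s (sigma n) >]) p.
Proof.
elim: p => [n | p IHp | p IHp q IHq] /=.
- by split=> [/asboolP | /asboolP].
- by rewrite IHp; split=> /negP.
- by rewrite IHp IHq; split=> /andP.
Qed.

Lemma simG_refl (M : model) G (s : state M) : simG G s s.
Proof. by move=> i _; have [r _ _] := sim_equiv M i; apply: r. Qed.

Lemma simG_sym (M : model) G (s t : state M) : simG G s t -> simG G t s.
Proof. by move=> st i iG; have [_ sy _] := sim_equiv M i; apply/sy/st. Qed.

Lemma simG_trans (M : model) G (s t u : state M) :
  simG G s t -> simG G t u -> simG G s u.
Proof.
by move=> st tu i iG; have [_ _ tr] := sim_equiv M i; apply: tr (st i iG) (tu i iG).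
Qed.

Lemma simG1 (M : model) i (s t : state M) : simG (group1 i) s t <-> sim i s t.
Proof. by split=> [|st j]; [apply; rewrite set11 | move/set1P->]. Qed.

(** One agent [k] common to both groups already brings all of $\sim_G$ into the intersection over
    $H$; the agents of $H$ outside $G$ keep their own relations. *)
Lemma simG_update_meet (M : model) G H (s t : state M) :
  val G :&: val H != set0 ->
  @simG _ _ (update M G) H s t <-> simG (groupU G H) s t.
Proof.
case/set0Pn=> k; rewrite inE => /andP[kG kH]; split=> st i.
  rewrite inE; case iG: (i \in val G) => /= iH.
    by have := st k kH; rewrite /= /upd_sim kG; apply.
  by have := st i iH; rewrite /= /upd_sim iG.
move=> iH; rewrite /= /upd_sim; case: ifP => _ => [j jG|]; apply: st.
  by rewrite inE jG.
by rewrite inE iH orbT.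
Qed.

Lemma simG_update_disjoint (M : model) G H (s t : state M) :
  val G :&: val H = set0 ->
  @simG _ _ (update M G) H s t <-> simG H s t.
Proof.
move=> GH0; split=> st i iH; have := st i iH; rewrite /= /upd_sim; case: ifP => // iG.
  by have := in_set0 i; rewrite -GH0 inE iG iH.
by have := in_set0 i; rewrite -GH0 inE iG iH.
Qed.

Lemma soundness phi : provable phi -> valid phi.
Proof.
elim=> {phi}.
- by move=> sigma p taut M s; apply/sat_psubst/taut.
- move=> i a b M s; apply/sat_imp=> sab; apply/sat_imp=> sa t st.
  by have /sat_imp := sab t st; apply; apply: sa.
- move=> i a M s; apply/sat_imp; apply.
  by have [r _ _] := sim_equiv M i; apply: r.
- move=> i a M s; apply/sat_imp=> sa t st u tu; apply: sa.
  by have [_ _ tr] := sim_equiv M i; apply: tr st tu.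
- move=> i a M s; apply/sat_imp=> nsa t st ta; apply: nsa => u su; apply: ta.
  by have [_ sy tr] := sim_equiv M i; apply: tr (sy _ _ st) su.
- by move=> a b _ IHa _ IHab M s; have /sat_imp := IHab M s; apply; apply: IHa.
- by move=> i a _ IHa M s t _; apply: IHa.
- move=> G a b M s; apply/sat_imp=> sab; apply/sat_imp=> sa t st.
  by have /sat_imp := sab t st; apply; apply: sa.
- by move=> G a M s; apply/sat_imp; apply; apply: simG_refl.
- move=> G a M s; apply/sat_imp=> nsa t st ta; apply: nsa => u su; apply: ta.
  exact: simG_trans (simG_sym st) su.
- by move=> i a M s; apply/sat_iff; split=> sa t /simG1; apply: sa.
- move=> G H a /subsetP sGH M s; apply/sat_imp=> sa t st; apply: sa => i iG.
  exact/st/sGH.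
- by move=> G p M s; apply/sat_iff.
- by move=> G a b M s; apply/sat_iff.
- by move=> G a M s; apply/sat_iff.
- move=> G H a GH M s; apply/sat_iff.
  by split=> sa t /(simG_update_meet s t GH); apply: sa.
- move=> G H a GH M s; apply/sat_iff.
  by split=> sa t /(simG_update_disjoint s t GH); apply: sa.
(* Validity ranges over all models, hence covers [update M G]. *)
- by move=> G a _ IHa M s; apply: IHa.
Qed.

(** * Maximal consistent sets *)

(** A maximal consistent set, given as its characteristic function: commuting with negation
    expresses both consistency and maximality. *)
Record ultra (w : form -> bool) : Prop := Ultra {
  ultra_provable : forall phi, provable phi -> w phi;
  ultra_neg : forall phi, w (FNeg phi) = ~~ w phi;
  ultra_and : forall phi psi, w (FAnd phi psi) = w phi && w psi
}.

Lemma ultra_imp w a b : ultra w -> w (FImp a b) = (w a ==> w b).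
Proof.
by move=> uw; rewrite ultra_neg // ultra_and // ultra_neg // negb_and negbK implybE.
Qed.

Lemma ultra_iff w a b : ultra w -> w (FIff a b) = (w a == w b).
Proof. by move=> uw; rewrite ultra_and // !ultra_imp //; case: (w a) (w b) => [] []. Qed.

Lemma ultra_mp w a b : ultra w -> provable (FImp a b) -> w a -> w b.
Proof. by move=> uw /(ultra_provable uw); rewrite ultra_imp // => /implyP. Qed.

Lemma ultra_eq w a b : ultra w -> provable (FIff a b) -> w a = w b.
Proof. by move=> uw /(ultra_provable uw); rewrite ultra_iff // => /eqP. Qed.

(** * Theories and propositional reasoning inside them *)

Record theory (T : form -> Prop) : Prop := Theory {
  theory_provable : forall phi, provable phi -> T phi;
  theory_mp : forall phi psi, T (FImp phi psi) -> T phi -> T psi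
}.

Definition PImp (p q : pform) : pform := PNeg (PAnd p (PNeg q)).

Definition form3 a b c (n : nat) : form := nth a [:: a; b; c] n.

Lemma taut3 a b c (p : pform) : tautology p -> provable (psubst (form3 a b c) p).
Proof. exact: RD_PC. Qed.

Local Notation x0 := (PVar 0).
Local Notation x1 := (PVar 1).
Local Notation x2 := (PVar 2).

Lemma provable_id a : provable (FImp a a).
Proof. by apply: (@taut3 a a a (PImp x0 x0)) => v /=; case: (v 0). Qed.

Lemma provable_const a b : provable (FImp b (FImp a b)).
Proof.
apply: (@taut3 a b b (PImp x1 (PImp x0 x1))) => v /=.
by case: (v 0) (v 1) => [] [].
Qed.

Lemma provable_distr a b c :
  provable (FImp (FImp a (FImp b c)) (FImp (FImp a b) (FImp a c))).
Proof.
apply: (@taut3 a b c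
  (PImp (PImp x0 (PImp x1 x2)) (PImp (PImp x0 x1) (PImp x0 x2)))) => v /=.
by case: (v 0) (v 1) (v 2) => [] [] [].
Qed.

Lemma provable_cases a c :
  provable (FImp (FImp a c) (FImp (FImp (FNeg a) c) c)).
Proof.
apply: (@taut3 a a c
  (PImp (PImp x0 x2) (PImp (PImp (PNeg x0) x2) x2))) => v /=.
by case: (v 0) (v 2) => [] [].
Qed.

Lemma provable_explosion a c : provable (FImp a (FImp (FNeg a) c)).
Proof.
apply: (@taut3 a a c (PImp x0 (PImp (PNeg x0) x2))) => v /=.
by case: (v 0) (v 2) => [] [].
Qed.

Lemma provable_andl a b : provable (FImp (FAnd a b) a).
Proof.
apply: (@taut3 a b b (PImp (PAnd x0 x1) x0)) => v /=.
by case: (v 0) (v 1) => [] [].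
Qed.

Lemma provable_andr a b : provable (FImp (FAnd a b) b).
Proof.
apply: (@taut3 a b b (PImp (PAnd x0 x1) x1)) => v /=.
by case: (v 0) (v 1) => [] [].
Qed.

Lemma provable_andI a b : provable (FImp a (FImp b (FAnd a b))).
Proof.
apply: (@taut3 a b b (PImp x0 (PImp x1 (PAnd x0 x1)))) => v /=.
by case: (v 0) (v 1) => [] [].
Qed.

Lemma theory_provable_mp T a b : theory T -> provable (FImp a b) -> T a -> T b.
Proof. by move=> tT /(theory_provable tT); apply: theory_mp. Qed.

Lemma theory_provable_mp2 T a b c :
  theory T -> provable (FImp a (FImp b c)) -> T a -> T b -> T c.
Proof. by move=> tT /(theory_provable_mp tT) ab /ab; apply: theory_mp. Qed.

(** By the deduction theorem, this is the theory generated by [T] and [a]. *)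
Lemma theory_extend T a : theory T -> theory (fun psi => T (FImp a psi)).
Proof.
move=> tT; split=> [phi /(theory_provable tT) | phi psi].
  exact/(theory_provable_mp tT)/provable_const.
exact/(theory_provable_mp2 tT)/provable_distr.
Qed.

(** * Enumeration of the formulas *)

Local Notation leaf := (prop + (ag + {G : {set ag} | G != set0}))%type.

Fixpoint encode phi : GenTree.tree leaf :=
  match phi with
  | FVar p => GenTree.Leaf (inl p)
  | FNeg a => GenTree.Node 0 [:: encode a]
  | FAnd a b => GenTree.Node 1 [:: encode a; encode b]
  | FK i a => GenTree.Node 2 [:: GenTree.Leaf (inr (inl i)); encode a]
  | FD G a => GenTree.Node 3 [:: GenTree.Leaf (inr (inr G)); encode a]
  | FR G a => GenTree.Node 4 [:: GenTree.Leaf (inr (inr G)); encode a]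
  end.

Fixpoint decode (t : GenTree.tree leaf) : option form :=
  match t with
  | GenTree.Leaf (inl p) => Some (FVar p)
  | GenTree.Node 0 [:: t] => omap (@FNeg _ _) (decode t)
  | GenTree.Node 1 [:: t; u] =>
      obind (fun a => omap (FAnd a) (decode u)) (decode t)
  | GenTree.Node 2 [:: GenTree.Leaf (inr (inl i)); t] => omap (FK i) (decode t)
  | GenTree.Node 3 [:: GenTree.Leaf (inr (inr G)); t] => omap (FD G) (decode t)
  | GenTree.Node 4 [:: GenTree.Leaf (inr (inr G)); t] => omap (FR G) (decode t)
  | _ => None
  end.

Lemma encodeK : pcancel encode decode.
Proof.
by elim=> //= [a -> | a -> b -> | i a -> | G a -> | G a ->].
Qed.

Definition enum_form (n : nat) : option form := obind decode (unpickle n).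

Lemma enum_form_pickle phi : enum_form (pickle (encode phi)) = Some phi.
Proof. by rewrite /enum_form pickleK /= encodeK. Qed.

(** * Lindenbaum's lemma *)

Section Lindenbaum.
Variables (T : form -> Prop) (chi : form).
Hypotheses (theoryT : theory T) (Tchi : ~ T chi).

(** The invariant is that [chi] stays out: the formula [a] is adjoined unless it would entail
    [chi]. *)
Fixpoint stage (n : nat) : form -> Prop :=
  if n is m.+1 then
    if enum_form m is Some a then
      if `[< stage m (FImp a chi) >] then stage m
      else fun psi => stage m (FImp a psi)
    else stage m
  else T.

Lemma stage_theory n : theory (stage n).
Proof.
elim: n => //= n IHn; case: (enum_form n) => // a.
by case: ifP => // _; apply: theory_extend.
Qed.

Lemma stage_chi n : ~ stage n chi.
Proof.
elim: n => //= n IHn; case: (enum_form n) => // a.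
by case: ifPn => // /asboolP.
Qed.

Lemma stageS n psi : stage n psi -> stage n.+1 psi.
Proof.
rewrite /=; case: (enum_form n) => // a; case: ifP => // _.
exact: theory_provable_mp (stage_theory n) (provable_const _ _).
Qed.

Lemma stage_le m n psi : m <= n -> stage m psi -> stage n psi.
Proof.
move/subnK<-; elim: (n - m) => // k IHk Sm.
by rewrite addSn; apply/stageS/IHk.
Qed.

Definition limit psi : Prop := exists n, stage n psi.

Lemma limit_theory : theory limit.
Proof.
split=> [phi pphi | phi psi [m Sm] [n Sn]].
  by exists 0; apply: theory_provable.
exists (maxn m n); apply: (theory_mp (stage_theory _) (phi := phi)).
  exact: stage_le (leq_maxl m n) Sm.
exact: stage_le (leq_maxr m n) Sn.
Qed.

Lemma limit_chi : ~ limit chi.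
Proof. by case=> n; apply: stage_chi. Qed.

Lemma limit_dec a : limit a \/ limit (FImp a chi).
Proof.
set n := pickle (encode a); case: (pselect (stage n (FImp a chi))) => [Sa | nSa].
  by right; exists n.
left; exists n.+1; rewrite /= enum_form_pickle asboolF //=.
exact/(theory_provable (stage_theory n))/provable_id.
Qed.

Lemma lindenbaum :
  exists w, [/\ ultra w, forall psi, T psi -> w psi & w chi = false].
Proof.
have tL := limit_theory.
exists (fun psi => `[< limit psi >]); split; first split.
- by move=> phi pphi; apply/asboolP/(theory_provable tL).
- move=> a; rewrite -asbool_neg; apply: asbool_equiv_eq.
  split=> [Lna La | nLa].
    exact/limit_chi/(theory_provable_mp2 tL (provable_explosion a chi)).
  (* If both [a] and its negation were rejected, each would imply [chi], and a case distinction
     would put [chi] in the limit. *)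
  case: (limit_dec a) => // Lac; case: (limit_dec (FNeg a)) => // Lnac.
  by case: limit_chi; apply: theory_provable_mp2 tL (provable_cases a chi) Lac Lnac.
- move=> a b; rewrite -asbool_and; apply: asbool_equiv_eq; split=> [Lab | [La Lb]].
    split; first exact: theory_provable_mp tL (provable_andl a b) Lab.
    exact: theory_provable_mp tL (provable_andr a b) Lab.
  exact: theory_provable_mp2 tL (provable_andI a b) La Lb.
- by move=> psi Tpsi; apply/asboolP; exists 0.
- exact/asboolF/limit_chi.
Qed.

End Lindenbaum.

Lemma provable_theory : theory (@provable prop ag).
Proof. by split=> // phi psi /[swap]; apply: RD_MP. Qed.

Lemma ultra_complete phi : (forall w, ultra w -> w phi) -> provable phi.
Proof.
move=> all_w; apply: contrapT => /(lindenbaum provable_theory)[w [uw _]].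
by rewrite all_w.
Qed.

(** * Distributed knowledge in maximal consistent sets *)

(** Necessitation for $D_G$ comes from that for $K_i$ with $i\in G$, through (D1) and (D2). *)
Lemma provable_ND G phi : provable phi -> provable (FD G phi).
Proof.
move=> pphi; have /set0Pn[i iG] := valP G.
apply: ultra_complete => w uw.
apply: (ultra_mp uw (@RD_D2 prop ag (group1 i) G phi _)); first by rewrite sub1set.
by rewrite -(ultra_eq uw (RD_D1 i phi)); apply/ultra_provable/RD_N.
Qed.

Lemma ultra_KD w G a b : ultra w -> w (FD G (FImp a b)) -> w (FD G a) -> w (FD G b).
Proof. by move=> uw /(ultra_mp uw (RD_KD G a b)); rewrite ultra_imp // => /implyP. Qed.

Lemma ultra_5D w G a : ultra w -> ~~ w (FD G a) -> w (FD G (FNeg (FD G a))).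
Proof. by move=> uw; rewrite -ultra_neg //; apply: ultra_mp uw (RD_5D G a). Qed.

Lemma ultra_4D w G a : ultra w -> w (FD G a) -> w (FD G (FD G a)).
Proof.
move=> uw wa.
(* Axiom 4 from T and 5: $D_G a$ gives $\neg D_G\neg D_G a$ by T, then $D_G\neg D_G\neg D_G a$ by 5;
   the contrapositive of 5 under $D_G$ turns this into $D_G D_G a$. *)
have /(ultra_5D uw) : ~~ w (FD G (FNeg (FD G a))).
  by apply/negP => /(ultra_mp uw (RD_TD _ _)); rewrite ultra_neg // wa.
apply: ultra_KD => //; apply/(ultra_provable uw)/provable_ND/ultra_complete => u uu.
rewrite ultra_imp // ultra_neg //; apply/implyP; apply: contraR.
exact: ultra_5D.
Qed.

(** Extend the theory $\{\psi \mid D_G\psi\in w\}$, which omits [phi]. By 4 and 5 it contains each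
    $D_G\psi$ or its negation, as [w] does. *)
Lemma ultra_D_witness w G phi : ultra w -> w (FD G phi) = false ->
  exists w', [/\ ultra w', forall psi, w' (FD G psi) = w (FD G psi) & w' phi = false].
Proof.
move=> uw wphi.
have tT : theory (fun psi => w (FD G psi)).
  split=> [a pa | a b]; first exact/(ultra_provable uw)/provable_ND.
  exact: ultra_KD.
have [|w' [uw' Tw' w'phi]] := lindenbaum tT (chi := phi); first by rewrite wphi.
exists w'; split=> // psi.
case wpsi: (w (FD G psi)); first exact/Tw'/ultra_4D.
by apply/negbTE; rewrite -ultra_neg //; apply/Tw'/ultra_5D; rewrite ?wpsi.
Qed.

(** $D_H\psi$ travels from one set to the other inside $D_G D_H\psi$, obtained by 4 and (D2) and
    opened by T. *)
Lemma ultra_D_sub w w' G H : ultra w -> ultra w' -> val H \subset val G ->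
    (forall psi, w' (FD G psi) = w (FD G psi)) ->
  forall psi, w' (FD H psi) = w (FD H psi).
Proof.
move=> uw uw' sHG eqG psi.
have transfer u u' : ultra u -> ultra u' ->
    (forall b, u' (FD G b) = u (FD G b)) -> u (FD H psi) -> u' (FD H psi).
  move=> uu uu' eq_u /(ultra_4D uu) /(ultra_mp uu (RD_D2 _ sHG)).
  by rewrite -eq_u; apply/ultra_mp/RD_TD.
by apply/idP/idP; apply: transfer.
Qed.

(** * The canonical model *)

Record cstate : Type := CState {
  thy : form -> bool;
  share : group ag -> ag -> form -> bool;
  thy_ultra : ultra thy;
  shareE : forall G psi,
    \big[addb/false]_(j in val G) share G j psi = thy (FD G psi)
}.

Definition csim i (x y : cstate) : Prop :=
  forall G psi, i \in val G -> share x G i psi = share y G i psi.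

Lemma csim_equiv i : Equivalence (csim i).
Proof.
split=> [x G psi // | x y xy G psi iG | x y z xy yz G psi iG].
  by rewrite xy.
by rewrite xy ?yz.
Qed.

Definition canonical : model :=
  @Model prop ag cstate csim csim_equiv (fun p x => thy x (FVar p)).

Lemma canonical_simG G (x y : state canonical) :
  simG G x y -> forall psi, thy y (FD G psi) = thy x (FD G psi).
Proof.
move=> xy psi; rewrite -!shareE; apply: eq_bigr => i iG.
by rewrite (xy i iG).
Qed.

(** The bit [d] is given to a single chosen element of [B]; when [B] is empty nobody receives it. *)
Lemma xor_pick (A B : {set ag}) (d : bool) : B \subset A ->
  \big[addb/false]_(j in A) ((Some j == [pick k in B]) && d) = (B != set0) && d.
Proof.
move=> sBA; case: pickP => [k kB | B0].
  have -> : B != set0 by apply/set0Pn; exists k.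
  rewrite (bigD1 k) /= ?(subsetP sBA) // eqxx big1 ?addbF // => j /andP[_ /negPf jk].
  by rewrite (inj_eq Some_inj) jk.
rewrite big1 // (_ : B = set0) ?eqxx //.
by apply/setP => k; rewrite inE B0.
Qed.

Lemma ultra_lift w : ultra w -> exists x : state canonical, thy x = w.
Proof.
move=> uw.
pose f H j psi := (Some j == [pick k in val H]) && w (FD H psi).
have fE G psi : \big[addb/false]_(j in val G) f G j psi = w (FD G psi).
  by rewrite xor_pick // (valP G).
by exists (CState uw fE).
Qed.

Lemma ultra_lift_simG (x : state canonical) G w : ultra w ->
    (forall psi, w (FD G psi) = thy x (FD G psi)) ->
  exists2 y : state canonical, simG G x y & thy y = w.
Proof.
move=> uw eqG.
(* For $H\not\subseteq G$, one member outside [G] flips its bit wherever [thy x] and [w] disagree on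
   $D_H\psi$; for $H\subseteq G$ they agree, so no flip is called for. *)
pose f H j psi := share x H j psi (+)
  ((Some j == [pick k in val H :\: val G]) && (thy x (FD H psi) (+) w (FD H psi))).
have fE H psi : \big[addb/false]_(j in val H) f H j psi = w (FD H psi).
  rewrite big_split /= shareE xor_pick ?subsetDl // setD_eq0.
  case: (boolP (val H \subset val G)) => [sHG | _] /=; last by rewrite addKb.
  by rewrite addbF (ultra_D_sub (thy_ultra x) uw sHG eqG).
exists (CState uw fE) => // i iG H psi iH /=; rewrite /f.
case: pickP => [k | _]; last by rewrite addbF.
rewrite inE (inj_eq Some_inj); case: eqP => [<- | _]; first by rewrite iG.
by rewrite addbF.
Qed.

(** * The truth lemma *)

(** The properties of the canonical model that the truth lemma uses, stated so that they survive
    updates. *)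
Record realises (M : model) (v : state M -> form -> bool) : Prop := Realises {
  realises_ultra : forall s, ultra (v s);
  realises_var : forall s p, val_of p s <-> v s (FVar p);
  realises_D : forall s t G phi, simG G s t -> v s (FD G phi) -> v t phi;
  realises_witness : forall s G phi, v s (FD G phi) = false ->
    exists2 t, simG G s t & v t phi = false
}.

Lemma realises_canonical : realises (M := canonical) thy.
Proof.
split=> [s | // | s t G phi st | s G phi sphi]; first exact: thy_ultra.
  rewrite -(canonical_simG st); exact: ultra_mp (thy_ultra t) (RD_TD G phi).
have [w [uw eqG wphi]] := ultra_D_witness (thy_ultra s) sphi.
have [t st tw] := ultra_lift_simG uw eqG.
by exists t; rewrite ?tw.
Qed.

(** The reduction axioms (RD1) and (RD2) replace [H] by the same group as the semantics of the
    update does. *)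
Lemma update_D (M : model) v G H : @realises M v -> exists H',
  (forall s phi, v s (FR G (FD H phi)) = v s (FD H' (FR G phi))) /\
  (forall s t : state M, @simG _ _ (update M G) H s t <-> simG H' s t).
Proof.
move=> rv; case: (eqVneq (val G :&: val H) set0) => GH.
  exists H; split=> [s phi | s t]; last exact: simG_update_disjoint.
  exact: ultra_eq (realises_ultra rv s) (RD_RD2 phi GH).
exists (groupU G H); split=> [s phi | s t]; last exact: simG_update_meet.
exact: ultra_eq (realises_ultra rv s) (RD_RD1 phi GH).
Qed.

Lemma realises_update (M : model) v G : @realises M v ->
  realises (M := update M G) (fun s phi => v s (FR G phi)).
Proof.
move=> rv; have uv := realises_ultra rv; split=> [s | s p | s t H phi | s H phi].
- split=> [phi pphi | phi | phi psi].
  + exact/(ultra_provable (uv s))/RD_NR.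
  + by rewrite (ultra_eq (uv s) (RD_RN G phi)) ultra_neg.
  + by rewrite (ultra_eq (uv s) (RD_RC G phi psi)) ultra_and.
- by rewrite (ultra_eq (uv s) (RD_RA G p)); exact: (realises_var rv s p).
- have [H' [-> simE]] := update_D G H rv => /simE; exact: (realises_D rv).
- have [H' [-> simE]] := update_D G H rv => /(realises_witness rv)[t st tphi].
  by exists t => //; apply/simE.
Qed.

Lemma truth_D (M : model) v G phi s : @realises M v ->
    (forall t, sat t phi <-> v t phi) ->
  (forall t, simG G s t -> sat t phi) <-> v s (FD G phi).
Proof.
move=> rv IH; split=> [sphi | vphi t st]; last exact/IH/(realises_D rv st).
by apply: contraT => /negbTE /(realises_witness rv)[t /sphi /IH ->].
Qed.

Lemma truth phi (M : model) v (s : state M) : realises v -> sat s phi <-> v s phi.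
Proof.
(* [M] and [v] are generalised because the case of $R_G$ applies the induction hypothesis to the
   updated model. *)
elim: phi M v s => [p | a IHa | a IHa b IHb | i a IHa | G a IHa | G a IHa] M v s rv /=.
- exact: realises_var.
- rewrite ultra_neg ?(IHa _ v) //; last exact: realises_ultra.
  by split=> /negP.
- rewrite ultra_and ?(IHa _ v) ?(IHb _ v) //; last exact: realises_ultra.
  by split=> /andP.
- rewrite (ultra_eq (realises_ultra rv s) (RD_D1 i a)).
  rewrite -(truth_D _ _ rv (fun t => IHa M v t rv)).
  by split=> sa t /simG1; apply: sa.
- exact: truth_D rv (fun t => IHa M v t rv).
- exact: (IHa (update M G) _ s (realises_update G rv)).
Qed.

Lemma completeness phi : valid phi -> provable phi.
Proof.
move=> vphi; apply: ultra_complete => w /ultra_lift[x <-].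
exact/(truth phi x realises_canonical)/vphi.
Qed.

End Completeness.

Theorem theorem1 (prop : countType) (ag : finType) (phi : form prop ag) :
  valid phi <-> provable phi.
Proof. by split; [apply: completeness | apply: soundness]. Qed.
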